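(* Let $q$ be a prime power and $d$ an integer with $5\le d\le q$; put $n=q+1$. Let $\mathcal C$ be the $[q+1,q+2-d,d]_q$ normalized generalized doubly extended Reed--Solomon (GDRS) code. Let $\mathcal V^{(2)}$ be a coset of weight $2$ of $\mathcal C$ with coset leader $\mathbf v_2(j_1,j_2;\gamma_1,\gamma_2)$, and let $\beta$ be a primitive element of $\mathbb F_q$ and $\lambda_0\in\mathbb Z_{q-1}$ be such that $\beta^{\lambda_0}=-\gamma_2/\gamma_1$. Then the weight distribution of $\mathcal V^{(2)}$ does not depend on the positions $j_1,j_2$, and: (i) $B_w(\mathcal V^{(2)})=0$ for $w\in\{0,1,\dots,d-3\}\setminus\{2\}$; $B_2(\mathcal V^{(2)})=1$; $B_{d-2}(\mathcal V^{(2)})=\mathrm P^+_{q-1,d-2}(\lambda_0)=\mathrm P^\times_{q,d-2}(-\gamma_2/\gamma_1)$; and for $w=d-1,d,\dots,q+1$, $$B_w(\mathcal V^{(2)})=A_w(\mathcal C)-\Omega^{(0)}_w+\Omega^{(2)}_w+(-1)^{w-d}\binom{q+3-d}{q+1-w}\mathrm P^+_{q-1,d-2}(\lambda_0).$$ (ii) The value $\mathrm P^+_{q-1,d-2}(\lambda)$ is the same for all $\lambda\in\mathbb Z_{q-1}$ if and only if all $\binom{n}{2}(q-1)^2$ cosets of weight $2$ of $\mathcal C$ have the same weight distribution; and in that case, for every coset $\mathcal V^{(2)}$ of weight $2$: $B_w(\mathcal V^{(2)})=0$ for $w\in\{0,\dots,d-3\}\setminus\{2\}$, $B_2(\mathcal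 V^{(2)})=1$, $B_{d-2}(\mathcal V^{(2)})=\frac{1}{q-1}\binom{q-1}{d-2}=\frac{1}{d-2}\binom{q-2}{d-3}$, and for $w=d-1,\dots,q+1$, $$B_w(\mathcal V^{(2)})=A_w(\mathcal C)-\Omega^{(0)}_w+\Omega^{(2)}_w+(-1)^{w-d}\binom{q+3-d}{q+1-w}\cdot\frac{1}{q-1}\binom{q-1}{d-2}.$$ (iii) If $\gcd(q-1,d-2)=1$, then $\mathrm P^+_{q-1,d-2}(\lambda)$ is the same for all $\lambda\in\mathbb Z_{q-1}$, all $\binom n2(q-1)^2$ cosets of weight $2$ have the same weight distribution, all formulas of (ii) hold, the code $\mathcal C$ is $2$-regular, and $\frac{1}{q-1}\binom{q-1}{d-2}=\frac{1}{d-2}\binom{q-2}{d-3}$ is an integer.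
   Context: Normalized GDRS code: the $\mathbb F_q$-linear code of length $q+1$ which is the kernel of the $(d-1)\times(q+1)$ parity check matrix whose first $q$ columns are $(1,m,m^2,\dots,m^{d-2})^{T}$ for $m$ running over all elements of $\mathbb F_q$ (the nonzero ones $m_1,\dots,m_{q-1}$ and then $m_q=0$) and whose last column is $(0,\dots,0,1)^{T}$; it is an MDS code with minimum distance $d$. A coset of a code $\mathcal C$ is $\mathbf v+\mathcal C$; its weight is the minimum Hamming weight of its vectors, and a coset leader is a vector of minimal weight. $\mathbf v_2(j_1,j_2;\gamma_1,\gamma_2)$ denotes the vector of $\mathbb F_q^{q+1}$ with entries $\gamma_1,\gamma_2\in\mathbb F_q^*$ in positions $j_1\ne j_2$ and zeros elsewhere. $B_w(\mathcal V)$ is the number of vectors of Hamming weight $w$ in the coset $\mathcal V$; $A_w(\mathcal C)$ is the number of codewords of weight $w$, given by $A_w(\mathcal C)=\binom{n}{w}\sum_{j=0}^{w-d}(-1)^j\binom wj(q^{w-d+1-j}-1)$ for $w\ge d$ and $0$ for $0<w<d$. Further $\Omega^{(0)}_w=(-1)^{w-d}\binom{q+1}{w}\binom{w-1}{d-2}$ and $\Omega^{(2)}_w=(-1)^{w-d}\binom{q-1}{w-2}\binom{w-3}{d-4}$. For positive integers $\mu<R$ and $\lambda\in\mathbb Z_R$ (integers mod $R$), $\mathrm P^+_{R,\mu}(\lambda)$ is the number of $\mu$-element subsets $\{\lambda_1,\dots,\lambda_\mu\}\subset\mathbb Z_R$ (distinct elements) with $\lambda_1+\dots+\lambda_\mu=\lambda$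 in $\mathbb Z_R$. For $\mu<q-1$ and $\gamma\in\mathbb F_q^*$, $\mathrm P^\times_{q,\mu}(\gamma)$ is the number of $\mu$-element subsets $\{\alpha_1,\dots,\alpha_\mu\}\subset\mathbb F_q^*$ with $\alpha_1\cdots\alpha_\mu=\gamma$. A code is $2$-regular if for every $W\in\{0,1,2\}$ all cosets of weight $W$ have the same weight distribution. *)

(* Defs.v *)
From HB Require Import structures.
From mathcomp Require Import all_boot all_order all_algebra.
Set Implicit Arguments. Unset Strict Implicit. Unset Printing Implicit Defensive.
Import Order.TTheory GRing.Theory Num.Theory.
Local Open Scope ring_scope.

(* Positions are 'I_(#|F|.+1) (length n = q+1 with q = #|F|).  The first q
   columns are indexed by m : 'I_#|F| -> F (a bijection listing the nonzero
   elements first and 0 last); column j of the parity check matrix is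
   (1, m_j, ..., m_j^(d-2))^T for j < q, and (0,...,0,1)^T for j = q. *)
Definition gdrs_H (F : finFieldType) (m : 'I_#|F| -> F) (d : nat)
  : 'M[F]_(d.-1, #|F|.+1) :=
  \matrix_(i < d.-1, j < #|F|.+1)
    (if @insub nat (fun k => k < #|F|)%N _ (val j) is Some k
     then (m k) ^+ i else ((val i == d.-2)%N)%:R).

Definition inC (F : finFieldType) (m : 'I_#|F| -> F) (d : nat)
  (v : 'rV[F]_(#|F|.+1)) : bool := gdrs_H m d *m v^T == 0.

Definition wt (F : finFieldType) (k : nat) (v : 'rV[F]_k) : nat :=
  #|[set j | v 0 j != 0]|.

Definition Bw (F : finFieldType) (m : 'I_#|F| -> F) (d : nat)
  (w : nat) (x : 'rV[F]_(#|F|.+1)) : nat :=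
  #|[set u : 'rV[F]_(#|F|.+1) | inC m d (u - x) && (wt u == w)]|.

Definition Aw (F : finFieldType) (m : 'I_#|F| -> F) (d : nat) (w : nat) : nat :=
  Bw m d w 0.

Definition coset_wt (F : finFieldType) (m : 'I_#|F| -> F) (d : nat)
  (x : 'rV[F]_(#|F|.+1)) : nat :=
  \big[minn/#|F|.+1]_(u : 'rV[F]_(#|F|.+1) | inC m d (u - x)) wt u.

Definition v2 (F : finFieldType) (k : nat) (j1 j2 : 'I_k) (g1 g2 : F)
  : 'rV[F]_k :=
  \row_j (if j == j1 then g1 else if j == j2 then g2 else 0).

Definition Pplus (R mu : nat) (lam : 'I_R) : nat :=
  #|[set S : {set 'I_R} |
      (#|S| == mu)%N && ((\sum_(i in S) val i) %% R == val lam)%N]|.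

Definition Ptimes (F : finFieldType) (mu : nat) (g : F) : nat :=
  #|[set S : {set F} |
      [&& 0 \notin S, (#|S| == mu)%N & \prod_(a in S) a == g]]|.

(* (-1)^(w-d), written (-1)^(w+d) to avoid truncated subtraction *)
Definition sgn (w d : nat) : int := (-1) ^+ (w + d).

Definition Omega0 (q d w : nat) : int :=
  sgn w d * ('C(q.+1, w) * 'C(w.-1, d - 2))%N%:Z.

Definition Omega2 (q d w : nat) : int :=
  sgn w d * ('C(q.-1, w - 2) * 'C(w - 3, d - 4))%N%:Z.

Definition two_regular (F : finFieldType) (m : 'I_#|F| -> F) (d : nat) : Prop :=
  forall W : nat, (W <= 2)%N ->
  forall x y : 'rV[F]_(#|F|.+1),
    coset_wt m d x = W -> coset_wt m d y = W ->
    forall w, Bw m d w x = Bw m d w y.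

Definition uniform_w2_formulas (F : finFieldType) (m : 'I_#|F| -> F) (d : nat)
  (x : 'rV[F]_(#|F|.+1)) : Prop :=
  let q := #|F| in
  let c : rat := ('C(q.-1, d - 2))%:R / (q.-1)%:R in
  [/\ forall w : nat, (w <= d - 3)%N -> w <> 2%N -> Bw m d w x = 0%N,
      Bw m d 2 x = 1%N,
      (Bw m d (d - 2) x)%:R = c,
      c = ('C(q - 2, d - 3))%:R / (d - 2)%:R &
      forall w : nat, (d - 1 <= w <= q.+1)%N ->
        (Bw m d w x)%:R =
          ((Aw m d w)%:Z - Omega0 q d w + Omega2 q d w)%:~R
          + (sgn w d)%:~R * ('C(q + 3 - d, q.+1 - w))%:R * c].

Arguments Pplus : clear implicits.

(* Main.v *)
Require Import Defs.
From HB Require Import structures.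
From mathcomp Require Import all_boot all_order all_algebra.
From mathcomp Require Import cyclic finfield.
From mathcomp Require Import zify ring.
Import Order.TTheory GRing.Theory Num.Theory.

(** View the q+1 positions as the points of the projective line over F_q, so
    that the columns of the parity check matrix lie on the rational normal curve
    of degree d-2.  For each set S of d-2 positions some combination of the rows
    of H has entry [\prod_(k in S) det(P_j, P_k)] at every position j.  These
    combinations show that any d-1 columns of H are independent (hence minimum
    distance d) and that a coset x + C has a vector supported on S iff the
    combination for S annihilates x.  For x = v2(j1,j2;g1,g2) and S disjoint from
    {j1,j2} this reads [\prod_(k in S) rho k = -g2/g1], where
    [rho k = det(P_j1,P_k) / det(P_j2,P_k)] maps the remaining positions
    bijectively onto F_q^*; this computes B_{d-2}.

    Every set of at least d-1 positions supports equally many vectors of each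
    coset, so the differences b_i = B_i(x) - A_i satisfy
    [\sum_i b_i 'C(n-i, r) = 0] for r + d-1 <= n.  Inverting these relations
    expresses all B_w in terms of B_0, ..., B_{d-2}. *)

(** * Binomial identities and inversion of binomial moments *)

Section Binomial.
Local Open Scope ring_scope.
Set Implicit Arguments. Unset Strict Implicit. Unset Printing Implicit Defensive.

Lemma mul_bin_bin (j k s : nat) :
  ('C(j, k + s) * 'C(k + s, k) = 'C(j, k) * 'C(j - k, s))%N.
Proof.
have [lt_j | le_j] := ltnP j (k + s).
  rewrite bin_small // mul0n; have [lt_jk | le_kj] := ltnP j k.
    by rewrite bin_small.
  by rewrite [X in (_ * X)%N]bin_small ?muln0 //; lia.
have le_kj : (k <= j)%N by lia.
have e1 := bin_fact le_j; have e2 := bin_fact (leq_addr s k).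
have e3 := bin_fact le_kj.
have /bin_fact e4 : (s <= j - k)%N by lia.
rewrite addKn in e2; rewrite -subnDA in e4.
have pos : (0 < k`! * s`! * (j - (k + s))`!)%N by rewrite !muln_gt0 !fact_gt0.
apply/eqP; rewrite -(eqn_pmul2r pos); apply/eqP.
by transitivity j`!; [rewrite -e1 -e2 | rewrite -e3 -e4]; ring.
Qed.

(** Pascal's rule makes the partial sums telescope. *)
Lemma alternating_bin_partial_sum (N K : nat) :
  \sum_(s < K.+1) (-1) ^+ s * 'C(N.+1, s)%:R = (-1) ^+ K * 'C(N, K)%:R :> int.
Proof.
elim: K => [|K IH]; first by rewrite big_ord1 !bin0.
by rewrite big_ord_recr /= IH binS natrD exprS; ring.
Qed.

(* The combination $\sum_s (-1)^s \binom{n-w+s}{s} E_{n-w+s}$ of the vanishing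
   moments $E_r$ isolates $b_w$. *)
Lemma binomial_moments_inversion (n D : nat) (b : nat -> int) :
  (0 < D)%N ->
  (forall r, (r + D <= n)%N -> \sum_(i < n.+1) b i * 'C(n - i, r)%:R = 0) ->
  forall w, (D <= w <= n)%N ->
  b w = (-1) ^+ (w + D).+1 *
        \sum_(i < D) b i * ('C(n - i, n - w) * 'C(w.-1 - i, D.-1 - i))%:R.
Proof.
move=> D0 E0 w /andP[Dw wn].
(* [g i] is the coefficient of [b i] in the combination of moments, once [mul_bin_bin] has pulled
   the factor free of [s] out of the sum. *)
pose g i : int := 'C(n - i, n - w)%:R *
  \sum_(s < (w - D).+1) (-1) ^+ s * 'C(n - i - (n - w), s)%:R.
have sum0 : \sum_(i < n.+1) b i * g i = 0.
  transitivity (\sum_(s < (w - D).+1) (-1) ^+ s * 'C(n - w + s, n - w)%:R *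
      (\sum_(i < n.+1) b i * 'C(n - i, n - w + s)%:R)); last first.
    apply: big1 => s _; rewrite E0 ?mulr0 //; have := ltn_ord s; lia.
  under [RHS]eq_bigr do rewrite mulr_sumr.
  rewrite exchange_big /=; apply: eq_bigr => i _.
  rewrite /g !mulr_sumr; apply: eq_bigr => s _.
  have := congr1 (fun k => k%:R : int) (mul_bin_bin (n - i) (n - w) s).
  rewrite !natrM => e.
  transitivity (b i * (-1) ^+ s *
      ('C(n - i, n - w)%:R * 'C(n - i - (n - w), s)%:R)); first by ring.
  by rewrite -e; ring.
have gw : g w = 1.
  rewrite /g binn mul1r subnn big_ord_recl bin0 expr0 mulr1 big1 ?addr0 // => s _.
  by rewrite bin0n mulr0.
(* Below [w] the inner sum is a truncated alternating sum. Its closed form vanishes for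
   [D <= i < w], because then [w.-1 - i < w - D]; only the indices below [D] and [w] itself
   survive. *)
have g_lt i : (i < w)%N ->
    g i = 'C(n - i, n - w)%:R * ((-1) ^+ (w - D) * 'C(w.-1 - i, w - D)%:R).
  move=> iw; rewrite /g.
  have -> : (n - i - (n - w) = (w.-1 - i).+1)%N by lia.
  by rewrite alternating_bin_partial_sum.
have g_gt i : (w < i <= n)%N -> g i = 0.
  by move=> /andP[wi le_in]; rewrite /g bin_small ?mul0r //; lia.
have g_mid i : (D <= i)%N -> (i < w)%N -> g i = 0.
  by move=> Di iw; rewrite g_lt // ['C(_, w - D)]bin_small ?mulr0 //; lia.
have mid0 : \sum_(D <= i < w) b i * g i = 0.
  rewrite big_nat_cond big1 // => i /andP[/andP[? ?] _].
  by rewrite g_mid ?mulr0.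
have hi0 : \sum_(w.+1 <= i < n.+1) b i * g i = 0.
  rewrite big_nat_cond big1 // => i /andP[/andP[? ?] _].
  by rewrite g_gt ?mulr0 //; lia.
move: sum0; rewrite -(big_mkord xpredT (fun i => b i * g i)).
rewrite (@big_cat_nat _ _ _ D) //=; last by lia.
rewrite [X in _ + X](@big_cat_nat _ _ _ w) //=; last by lia.
rewrite (big_ltn (m := w)) ?ltnS // gw mid0 hi0.
rewrite big_mkord add0r addr0 mulr1 => /eqP.
rewrite addrC addr_eq0 => /eqP ->.
rewrite -sumrN mulr_sumr; apply: eq_bigr => i _.
have iD := ltn_ord i.
rewrite g_lt; last by lia.
have -> : 'C(w.-1 - i, w - D) = 'C(w.-1 - i, D.-1 - i).
  by rewrite -[RHS]bin_sub; [congr binomial; lia | lia].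
have -> : (-1) ^+ (w + D).+1 = - (-1) ^+ (w - D) :> int.
  have -> : (w + D).+1 = (w - D + (D + D).+1)%N by lia.
  by rewrite exprD exprS -(signr_odd _ (D + D)) oddD addbb expr0 mulr1 mulrN1.
by rewrite natrM; ring.
Qed.

End Binomial.

(** * Intermediate subsets and transport of subset products *)

Section FiniteSets.
Set Implicit Arguments. Unset Strict Implicit. Unset Printing Implicit Defensive.

Lemma intermediate_set (T : finType) (A B : {set T}) (k : nat) :
  A \subset B -> #|A| <= k <= #|B| ->
  exists S : {set T}, [/\ A \subset S, S \subset B & #|S| = k].
Proof.
move=> AB /andP[+ kB].
elim: k kB => [|k IH] kB Ak.
  by exists A; split=> //; apply/eqP; rewrite eqn_leq Ak.
move: Ak; rewrite leq_eqVlt => /orP[/eqP <- | Ak]; first by exists A.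
have [S [AS SB cS]] := IH (ltnW kB) Ak.
have /properP[_ [x xB xS]] : S \proper B.
  by rewrite properEcard SB cS.
exists (x |: S); split; last by rewrite cardsU1 xS cS.
  exact: subset_trans AS (subsetUr _ _).
by rewrite subUset sub1set xB.
Qed.

(** Taking images under a bijection of [D] onto the nonzero elements preserves cardinalities and
    products. It is applied to scaling by a constant, to powers of a primitive element and to
    [det_ratio]. *)
Lemma card_prod_subsets_Ptimes (F : finFieldType) (I : finType) (f : I -> F)
    (D : {set I}) (mu : nat) (g : F) :
  {in D &, injective f} -> f @: D = [set~ 0%R] ->
  #|[set S : {set I} |
      [&& S \subset D, #|S| == mu & (\prod_(i in S) f i)%R == g]]|
  = Ptimes mu g.
Proof.
move=> injf fD; rewrite /Ptimes.
have injS (S : {set I}) : S \subset D -> {in S &, injective f}.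
  by move=> /subsetP SD x y /SD xD /SD yD; apply: injf.
set P := [set S : {set I} | _].
have imP : [set S' : {set F} | [&& 0%R \notin S', #|S'| == mu
      & (\prod_(a in S') a)%R == g]] = (fun S : {set I} => f @: S) @: P.
  apply/setP => S'; rewrite inE; apply/and3P/imsetP => [[S0 cS pS] | [S SP ->]].
    (* The preimage is cut down to [D], since [f] is controlled only there. *)
    pose S := D :&: f @^-1: S'.
    have SD : S \subset D by apply: subsetIl.
    have eS : f @: S = S'.
      apply/setP => a; apply/imsetP/idP => [[x] | aS].
        by rewrite !inE => /andP[_ ?] ->.
      have : a \in f @: D.
        by rewrite fD !inE; apply: contraNneq S0 => <-.
      by case/imsetP => x xD ax; exists x => //; rewrite !inE xD -ax.
    exists S; last by rewrite eS.
    rewrite inE SD -(card_in_imset (injS _ SD)) eS cS /=.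
    by rewrite -(big_imset id (injS _ SD)) /= eS.
  move: SP; rewrite inE => /and3P[SD cS pS].
  rewrite (card_in_imset (injS _ SD)) (big_imset id (injS _ SD)) /=; split=> //.
  apply/negP => /(subsetP (imsetS f SD)).
  by rewrite fD !inE eqxx.
rewrite imP card_in_imset // => S1 S2; rewrite !inE => /andP[S1D _] /andP[S2D _] e.
have sub (A B : {set I}) : A \subset D -> B \subset D -> f @: A = f @: B -> A \subset B.
  move=> AD BD eAB; apply/subsetP => x xA.
  have : f x \in f @: B by rewrite -eAB imset_f.
  case/imsetP => y yB /injf -> //; [exact: (subsetP AD) | exact: (subsetP BD)].
by apply/eqP; rewrite eqEsubset; apply/andP; split; apply: sub.
Qed.

End FiniteSets.

(** * Subset products in the multiplicative group and subset sums modulo q-1 *)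

Section SubsetProducts.
Local Open Scope ring_scope.
Set Implicit Arguments. Unset Strict Implicit. Unset Printing Implicit Defensive.
Variable F : finFieldType.

Lemma expf_card_pred (x : F) : x != 0 -> x ^+ #|F|.-1 = 1.
Proof.
move=> x0; apply: (mulfI x0); rewrite -exprS prednK ?mulr1 ?expf_card //.
by apply/card_gt0P; exists 0.
Qed.

Lemma exists_primitive_element : exists beta : F, (#|F|.-1).-primitive_root beta.
Proof.
have sz : size (enum [set~ (0 : F)]) = #|F|.-1 by rewrite -cardE cardsC1.
have q1 : (0 < #|F|.-1)%N by rewrite -ltnS (ltn_predK (finNzRing_gt1 F)) finNzRing_gt1.
have /hasP[beta _ ?] : has (#|F|.-1).-primitive_root (enum [set~ (0 : F)]).
  apply: has_prim_root; rewrite ?enum_uniq ?sz //.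
  apply/allP => x; rewrite mem_enum !inE => x0.
  by rewrite unity_rootE expf_card_pred.
by exists beta.
Qed.

(** Scaling a [mu]-subset by [h] multiplies its product by [h ^+ mu]. *)
Lemma Ptimes_mul_exp (mu : nat) (g h : F) : h != 0 ->
  Ptimes mu (h ^+ mu * g) = Ptimes mu g.
Proof.
move=> h0; have inj : {in [set~ 0] &, injective (fun a : F => h * a)}.
  by move=> a b _ _; apply: mulfI.
have im : (fun a : F => h * a) @: [set~ 0] = [set~ 0].
  apply/eqP; rewrite eqEcard card_in_imset // leqnn andbT.
  by apply/subsetP => _ /imsetP[a + ->]; rewrite !inE mulf_eq0 negb_or h0.
rewrite -(card_prod_subsets_Ptimes mu _ inj im); congr #|pred_of_set _|.
apply/setP => S; rewrite !inE -disjoints_subset disjoint_sym disjoints1; congr andb.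
have [/eqP cS|//] := boolP (#|S| == mu).
by rewrite /= big_split /= prodr_const cS (inj_eq (mulfI _)) // expf_neq0.
Qed.

Section PrimitiveElement.
Variable beta : F.
Hypothesis beta_prim : (#|F|.-1).-primitive_root beta.

(** When [mu] is coprime to q-1, [beta ^+ mu] is again primitive, so every quotient [g / h] is a
    [mu]-th power and [Ptimes_mul_exp] applies. *)
Lemma Ptimes_coprime (mu : nat) (g h : F) : coprime #|F|.-1 mu ->
  g != 0 -> h != 0 -> Ptimes mu g = Ptimes mu h.
Proof.
move=> co g0 h0; have prim_mu : (#|F|.-1).-primitive_root (beta ^+ mu).
  by rewrite prim_root_exp_coprime // coprime_sym.
have q1 := prim_order_gt0 beta_prim.
have [i ei] := prim_rootP prim_mu (expf_card_pred (mulf_neq0 g0 (invr_neq0 h0))).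
rewrite -[g](divfK h0) ei exprAC Ptimes_mul_exp // expf_neq0 //.
by rewrite (prim_root_eq0 beta_prim) -lt0n.
Qed.

(** The discrete logarithm to base [beta] turns products into sums modulo q-1. *)
Lemma Pplus_Ptimes (mu : nat) (lam : 'I_#|F|.-1) :
  Pplus #|F|.-1 mu lam = Ptimes mu (beta ^+ lam).
Proof.
have b0 : beta != 0.
  by rewrite (prim_root_eq0 beta_prim) -lt0n (prim_order_gt0 beta_prim).
pose f (i : 'I_#|F|.-1) := beta ^+ i.
have injf : {in setT &, injective f}.
  move=> i j _ _ /eqP; rewrite (eq_prim_root_expr beta_prim) => /eqP.
  by rewrite !modn_small // => /val_inj.
have imf : f @: setT = [set~ 0].
  apply/eqP; rewrite eqEcard (card_in_imset injf) cardsT card_ord cardsC1 leqnn.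
  by rewrite andbT; apply/subsetP => _ /imsetP[i _ ->]; rewrite !inE expf_neq0.
rewrite -(card_prod_subsets_Ptimes mu _ injf imf); congr #|pred_of_set _|.
apply/setP => S; rewrite !inE subsetT /=; congr andb.
by rewrite prodrXr (eq_prim_root_expr beta_prim) [(lam %% _)%N]modn_small.
Qed.

End PrimitiveElement.

Lemma sum_Pplus (R mu : nat) : (0 < R)%N ->
  (\sum_(lam < R) Pplus R mu lam = 'C(R, mu))%N.
Proof.
move=> R0; rewrite -[in RHS](card_ord R) -card_draws -sum1_card.
pose s (S : {set 'I_R}) : 'I_R :=
  Ordinal (ltn_pmod (\sum_(i in S) val i)%N R0).
rewrite (partition_big s xpredT) //=; apply: eq_bigr => lam _.
rewrite /Pplus -sum1_card; apply: eq_bigl => S.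
by rewrite !inE -(inj_eq val_inj).
Qed.

Lemma Pplus_uniform (R mu : nat) (lam : 'I_R) :
  (forall l1 l2 : 'I_R, Pplus R mu l1 = Pplus R mu l2) ->
  (R * Pplus R mu lam = 'C(R, mu))%N.
Proof.
move=> e; have R0 : (0 < R)%N by case: R lam {e} => [[]|].
rewrite -sum_Pplus // (eq_bigr (fun=> Pplus R mu lam)) => [|l _]; last exact: e.
by rewrite sum_nat_const card_ord.
Qed.

End SubsetProducts.

(** * The parity check matrix as points of a rational normal curve *)

Section GDRS.
Local Open Scope ring_scope.
Set Implicit Arguments. Unset Strict Implicit. Unset Printing Implicit Defensive.

Variables (F : finFieldType) (m : 'I_#|F| -> F) (d : nat).
Local Notation n := #|F|.+1.
Local Notation vec := 'rV[F]_n.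
Local Notation H := (gdrs_H m d).
Hypotheses (m_inj : injective m) (d_ge2 : (2 <= d)%N) (d_le : (d <= n)%N).

(* Position [j] is the point [(col_x j : col_y j)] of the projective line; the
   column of [H] at [j] is its image on the rational normal curve. *)
Definition col_x (j : 'I_n) : F :=
  if @insub nat (fun k => k < #|F|)%N _ (val j) is Some k then m k else 1.
Definition col_y (j : 'I_n) : F :=
  if @insub nat (fun k => k < #|F|)%N 'I_#|F| (val j) is Some _ then 1 else 0.
Definition col_det (j k : 'I_n) : F := col_x j * col_y k - col_x k * col_y j.

(** Distinct positions are distinct projective points: [m] separates the finite ones, and only one
    position lies outside its range. *)
Lemma col_det_eq0 j k : (col_det j k == 0) = (j == k).
Proof.
apply/eqP/eqP => [|->]; last by rewrite /col_det subrr.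
rewrite /col_det /col_x /col_y; case: insubP => [a _ ea | nj]; case: insubP => [b _ eb | nk].
- rewrite !mulr1 => /subr0_eq /m_inj eab; apply: val_inj.
  by rewrite -ea -eb eab.
- by rewrite mulr0 mulr1 sub0r => /eqP; rewrite oppr_eq0 oner_eq0.
- by rewrite mulr0 mulr1 subr0 => /eqP; rewrite oner_eq0.
- move=> _; apply: val_inj => /=; have := ltn_ord j; have := ltn_ord k.
  by move: nj nk => /=; lia.
Qed.

Lemma col_det_pluecker j1 j2 k k' :
  col_det j1 k * col_det j2 k' - col_det j1 k' * col_det j2 k
  = col_det j1 j2 * col_det k k'.
Proof. by rewrite /col_det; ring. Qed.

(** The coefficient of degree [#|S|] serves as the value at infinity, even when some [a k] is zero
    and the degree drops. *)
Lemma coef_prod_linear (I : finType) (S : {set I}) (a b : I -> F) :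
  let p := \prod_(k in S) (a k *: 'X - (b k)%:P) in
  (size p <= #|S|.+1)%N /\ p`_#|S| = \prod_(k in S) a k.
Proof.
rewrite /= -big_enum -[\prod_(k in S) a k]big_enum cardE /=.
elim: (enum S) => [|k s [IHs IHc]]; first by rewrite !big_nil size_polyC oner_eq0 coefC.
rewrite !big_cons /=; set p := \prod_(j <- s) _ in IHs IHc *.
split.
  apply: leq_trans (size_polyMleq _ _) _.
  suff : (size (a k *: 'X - (b k)%:P)%R <= 2)%N.
    by move=> s2; rewrite -subn1 leq_subLR (leq_trans (leq_add s2 IHs)).
  rewrite (leq_trans (size_polyD _ _)) // geq_max size_polyN.
  rewrite (leq_trans (size_scale_leq _ _)) ?size_polyX //=.
  by rewrite (leq_trans (size_polyC_leq1 _)).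
rewrite mulrBl coefB -scalerAl coefZ coefXM /= IHc coefCM.
by rewrite [p`_(size s).+1]nth_default ?mulr0 ?subr0.
Qed.

(** The entries of [y] are the coefficients of a product of linear factors, one for each point of
    [S]: a finite column of [H] evaluates this polynomial, and the last column reads off its
    coefficient of degree d-2. *)
Lemma exists_vanishing_comb (S : {set 'I_n}) : #|S| = (d - 2)%N ->
  exists y : 'rV[F]_(d.-1), forall j, (y *m H) 0 j = \prod_(k in S) col_det j k.
Proof.
move=> cS; pose p : {poly F} := \prod_(k in S) (col_y k *: 'X - (col_x k)%:P).
have [sp cp] := coef_prod_linear S col_y col_x.
rewrite -/p cS in sp cp.
exists (\row_i p`_i) => j; rewrite mxE.
under [LHS]eq_bigr => i _ do rewrite mxE [H i j]mxE.
rewrite /col_det; move: (erefl (col_x j)) (erefl (col_y j)).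
rewrite {2}/col_x {2}/col_y; case: insubP => [a _ ea | nj] /= -> ->.
  rewrite -(@horner_coef_wide _ d.-1 p (m a)); last by apply: leq_trans sp _; lia.
  rewrite horner_prod; apply: eq_bigr => k _.
  by rewrite !hornerE [m a * _]mulrC.
have d2 : (d - 2 < d.-1)%N by lia.
rewrite (bigD1 (Ordinal d2)) //= big1 => [|i ni]; last first.
  rewrite (_ : (val i == d.-2)%N = false) ?mulr0 //.
  by apply: contraNF ni => /eqP ei; apply/eqP/val_inj; rewrite ei /=; lia.
rewrite (_ : (d - 2)%N == d.-2) ?mulr1 ?addr0 ?cp; last by lia.
by apply: eq_bigr => k _; rewrite mul1r mulr0 subr0.
Qed.

(** * Codewords, minimum distance and coset representatives *)

Lemma inC0 : inC m d 0.
Proof. by rewrite /inC trmx0 mulmx0. Qed.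

Lemma inC_add u v : inC m d u -> inC m d v -> inC m d (u + v).
Proof. by rewrite /inC linearD mulmxDr => /eqP-> /eqP->; rewrite addr0. Qed.

Lemma inC_opp u : inC m d (- u) = inC m d u.
Proof. by rewrite /inC linearN mulmxN oppr_eq0. Qed.

Lemma inC_sub_trans u v w : inC m d (u - v) -> inC m d (v - w) -> inC m d (u - w).
Proof. by move=> uv vw; have := inC_add uv vw; rewrite addrA subrK. Qed.

Lemma inC_sub_sym u v : inC m d (u - v) = inC m d (v - u).
Proof. by rewrite -inC_opp opprB. Qed.

Lemma inC_dot u (y : 'rV[F]_(d.-1)) : inC m d u ->
  \sum_j (y *m H) 0 j * u 0 j = 0.
Proof.
move=> /eqP uC; have : (y *m (H *m u^T)) 0 0 = 0 by rewrite uC mulmx0 mxE.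
by rewrite mulmxA mxE => e; rewrite -[RHS]e; apply: eq_bigr => j _; rewrite [u^T _ _]mxE.
Qed.

Definition supp (u : vec) : {set 'I_n} := [set j | u 0 j != 0].

Lemma card_supp (u : vec) : #|supp u| = wt u. Proof. by []. Qed.

Lemma suppN u j : (j \notin supp u) = (u 0 j == 0).
Proof. by rewrite inE negbK. Qed.

Lemma wt_le (u : vec) : (wt u <= n)%N.
Proof. by rewrite /wt; apply: leq_trans (max_card _) _; rewrite card_ord. Qed.

Lemma wt0P (u : vec) : reflect (u = 0) (wt u == 0%N).
Proof.
apply: (iffP eqP) => [/eqP|->].
  rewrite cards_eq0 => /eqP/setP e; apply/rowP => j.
  by have := e j; rewrite !inE mxE => /negbFE/eqP.
by apply/eqP; rewrite cards_eq0; apply/eqP/setP => j; rewrite !inE mxE eqxx.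
Qed.

Lemma supp_sub u v : supp (u - v) \subset supp u :|: supp v.
Proof.
apply/subsetP => j; rewrite !inE !mxE; apply: contraNT.
by rewrite negb_or !negbK => /andP[/eqP-> /eqP->]; rewrite subrr.
Qed.

Lemma wt_sub_le (u v : vec) : (wt (u - v) <= wt u + wt v)%N.
Proof.
apply: leq_trans (subset_leq_card (supp_sub u v)) _.
by rewrite cardsU leq_subr.
Qed.

Lemma prod_col_det_neq0 (S : {set 'I_n}) j :
  (\prod_(k in S) col_det j k != 0) = (j \notin S).
Proof.
apply/prodf_neq0/idP => [nz | jS k kS].
  by apply/negP => jS; have := nz j jS; rewrite col_det_eq0 eqxx.
by rewrite col_det_eq0; apply: contraNneq jS => ->.
Qed.

Lemma prod_col_det_eq0 (S : {set 'I_n}) j :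
  j \in S -> \prod_(k in S) col_det j k = 0.
Proof. by move=> jS; apply/eqP/negPn; rewrite prod_col_det_neq0 jS. Qed.

(** If [j] is in the support of [c], the other support positions fit into a set [S] of size d-2
    avoiding [j]. The parity check for [S] then has a single nonzero term, at [j], contradicting its
    vanishing on [c]. *)
Lemma inC_min_dist (c : vec) : inC m d c -> (wt c < d)%N -> c = 0.
Proof.
move=> cC wc; apply/eqP/negPn/negP => nz.
have [j jc] : exists j, j \in supp c.
  by apply/set0Pn; rewrite -cards_eq0; apply: contraNN nz => /wt0P ->.
have [||S [cS Sj /exists_vanishing_comb[y yS]]] :=
    @intermediate_set _ (supp c :\ j) [set~ j] (d - 2).
- by rewrite setDE subsetIr.
- by have := cardsD1 j (supp c); rewrite jc card_supp cardsC1 card_ord; lia.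
have := inC_dot y cC; rewrite (bigD1 j) //= big1 => [|k kj].
  rewrite addr0 yS => /eqP; rewrite mulf_eq0 => /orP[]; last first.
    by move: jc; rewrite inE => /negPf ->.
  apply/negP; rewrite prod_col_det_neq0.
  by apply/negP => /(subsetP Sj); rewrite !inE eqxx.
rewrite yS; have [kc|] := boolP (k \in supp c); last first.
  by rewrite suppN => /eqP->; rewrite mulr0.
by rewrite prod_col_det_eq0 ?mul0r // (subsetP cS) // !inE kj; move: kc; rewrite inE.
Qed.

(** Any d-1 columns of [H] form an invertible matrix, so the syndrome of [x] is attained by a vector
    supported on d-1 positions of [T]. *)
Lemma coset_rep_on (T : {set 'I_n}) x : (d.-1 <= #|T|)%N ->
  exists u, inC m d (u - x) /\ supp u \subset T.
Proof.
move=> dT; have [|S [_ ST cS]] := @intermediate_set _ set0 T d.-1 (sub0set _).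
  by rewrite cards0.
pose f (k : 'I_d.-1) : 'I_n := enum_val (cast_ord (esym cS) k).
have f_inj : injective f by move=> a b /enum_val_inj /cast_ord_inj.
have fS k : f k \in S by apply: enum_valP.
(* [E] places d-1 coordinates at the positions of [S], so [H *m E] is the submatrix of the columns
   in [S]. A vector of its kernel would be a codeword of weight below d. *)
pose E : 'M[F]_(n, d.-1) := \matrix_(j, k) (j == f k)%:R.
have suppE (a : 'cV[F]_d.-1) : supp (E *m a)^T \subset S.
  apply/subsetP => j; rewrite inE !mxE; apply: contraNT => jS.
  rewrite big1 // => k _; rewrite mxE (_ : (j == f k) = false) ?mul0r //.
  by apply: contraNF jS => /eqP->.
have EM : H *m E \in unitmx.
  rewrite -unitmx_tr -row_free_unit; apply: inj_row_free => v.
  rewrite trmx_mul mulmxA => v0.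
  have c0 : (E *m v^T)^T = 0.
    apply: inC_min_dist.
      by move/(congr1 trmx): v0; rewrite !trmx_mul trmx0 !trmxK /inC trmx_mul !trmxK => ->.
    by have := subset_leq_card (suppE v^T); rewrite cS card_supp; lia.
  apply/rowP => k; have := congr1 (fun A : vec => A 0 (f k)) c0.
  rewrite !mxE (bigD1 k) //= !mxE eqxx mul1r big1 ?addr0 // => l lk.
  by rewrite mxE (inj_eq f_inj) eq_sym (negPf lk) mul0r.
exists (E *m (invmx (H *m E) *m (H *m x^T)))^T; split.
  by rewrite /inC linearB /= trmxK mulmxBr !mulmxA mulmxV // mul1mx subrr.
exact: subset_trans (suppE _) ST.
Qed.

(** The value of the parity check for [S] is constant on the coset and zero on vectors supported on
    [S]. Conversely, take a representative on [S] and one extra position [j]: the check is nonzero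
    at [j], so its vanishing forces the entry at [j] to be zero. *)
Lemma coset_rep_vanishing (S : {set 'I_n}) x (y : 'rV[F]_(d.-1)) :
  #|S| = (d - 2)%N ->
  (forall j, (y *m H) 0 j = \prod_(k in S) col_det j k) ->
  (exists u, inC m d (u - x) /\ supp u \subset S) <->
  \sum_j (y *m H) 0 j * x 0 j = 0.
Proof.
move=> cS yS; have dotB u : inC m d (u - x) ->
    \sum_j (y *m H) 0 j * u 0 j = \sum_j (y *m H) 0 j * x 0 j.
  move=> /(inC_dot y) e; apply/eqP; rewrite -subr_eq0 -[X in _ == X]e -sumrB.
  by apply/eqP/eq_bigr => j _; rewrite !mxE mulrBr.
split=> [[u [/dotB <- uS]] | x0].
  apply: big1 => j _; have [jS|jS] := boolP (j \in S).
    by rewrite yS prod_col_det_eq0 ?mul0r.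
  have : j \notin supp u by apply: contraNN jS => /(subsetP uS).
  by rewrite suppN => /eqP->; rewrite mulr0.
have [j jS] : exists j, j \in ~: S.
  by apply/set0Pn; rewrite -card_gt0; have := cardsC S; rewrite card_ord cS; lia.
rewrite inE in jS.
have [|u [uC uS]] := @coset_rep_on (j |: S) x; first by rewrite cardsU1 jS cS; lia.
exists u; split=> //; apply/subsetP => k ku.
have := subsetP uS k ku; rewrite !inE => /orP[/eqP ekj | //].
have := dotB _ uC; rewrite x0 (bigD1 j) //= big1 ?addr0 => [|i ij].
  move/eqP; rewrite mulf_eq0 yS (negPf (_ : \prod_(k in S) col_det j k != 0)).
    by move: ku; rewrite ekj inE => /negPf ->.
  by rewrite prod_col_det_neq0.
have [iS|iS] := boolP (i \in S).
  by rewrite yS prod_col_det_eq0 ?mul0r.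
have : i \notin supp u.
  by apply: contraNN iS => /(subsetP uS); rewrite !inE (negPf ij).
by rewrite suppN => /eqP->; rewrite mulr0.
Qed.

(** * Weight distributions of cosets *)

Lemma eq_Bw_coset w x y : inC m d (x - y) -> Bw m d w x = Bw m d w y.
Proof.
move=> xy; rewrite /Bw; congr #|pred_of_set _|; apply/setP => u; rewrite !inE.
congr (_ && _); apply/idP/idP => [ux | uy]; first exact: inC_sub_trans xy.
by apply: inC_sub_trans uy _; rewrite inC_sub_sym.
Qed.

Lemma Bw_gt w x : (n < w)%N -> Bw m d w x = 0%N.
Proof.
move=> nw; apply/eqP; rewrite cards_eq0; apply/eqP/setP => u; rewrite !inE.
by have := wt_le u; case: eqP => [->|]; rewrite ?andbF //; lia.
Qed.

(** At least d-1 positions lie outside [Z], so the coset has a vector [u0] vanishing on [Z];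
    translation by [u0] is the bijection. *)
Lemma card_coset_zeros (Z : {set 'I_n}) x : (#|Z| + d.-1 <= n)%N ->
  #|[set u | inC m d (u - x) && (Z \subset ~: supp u)]| =
  #|[set u | inC m d (u - 0) && (Z \subset ~: supp u)]|.
Proof.
move=> cZ; have [|u0 [u0C u0Z]] := @coset_rep_on (~: Z) x.
  by have := cardsC Z; rewrite card_ord; lia.
have u0Z0 j : j \in Z -> u0 0 j = 0.
  move=> jZ; apply/eqP; rewrite -suppN; apply/negP => /(subsetP u0Z).
  by rewrite inE jZ.
have zP (u : vec) : reflect (forall j, j \in Z -> u 0 j = 0) (Z \subset ~: supp u).
  apply: (iffP subsetP) => h j /h; first by rewrite inE suppN => /eqP.
  by rewrite inE suppN => ->.
rewrite -[RHS](card_imset _ (@addIr _ u0)); congr #|pred_of_set _|; apply/setP => u.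
rewrite inE; apply/andP/imsetP => [[ux /zP uZ] | [v]].
  exists (u - u0); last by rewrite subrK.
  rewrite inE subr0; apply/andP; split.
    by apply: inC_sub_trans ux _; rewrite inC_sub_sym.
  by apply/zP => j jZ; rewrite !mxE uZ // u0Z0 // subr0.
rewrite inE subr0 => /andP[vC /zP vZ] ->; split.
  by rewrite -addrA; apply: inC_add.
by apply/zP => j jZ; rewrite !mxE vZ // u0Z0 // addr0.
Qed.

(** Double counting of pairs of a coset vector and an [r]-set of its zero positions. *)
Lemma sum_Bw_bin x r :
  (\sum_(i < n.+1) Bw m d i x * 'C(n - i, r) =
   \sum_(Z : {set 'I_n} | #|Z| == r)
     #|[set u | inC m d (u - x) && (Z \subset ~: supp u)]|)%N.
Proof.
transitivity (\sum_(u : vec | inC m d (u - x)) 'C(n - wt u, r))%N.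
  rewrite (partition_big (fun u => inord (wt u) : 'I_n.+1) xpredT) //=.
  apply: eq_bigr => i _; rewrite -sum_nat_const big_mkcond [RHS]big_mkcond /=.
  apply: eq_bigr => u _; rewrite inE -(inj_eq val_inj) /= inordK ?ltnS ?wt_le //.
  by case: eqP => [->|]; rewrite ?andbF.
transitivity (\sum_(u : vec | inC m d (u - x))
    \sum_(Z : {set 'I_n} | #|Z| == r) (Z \subset ~: supp u))%N.
  apply: eq_bigr => u _.
  have -> : (n - wt u)%N = #|~: supp u|.
    by have := cardsC (supp u); rewrite card_ord card_supp; lia.
  rewrite -cards_draws -sum1_card big_mkcond [RHS]big_mkcond /=.
  by apply: eq_bigr => Z _; rewrite inE; case: (Z \subset _); case: (_ == _).
rewrite exchange_big /=; apply: eq_bigr => Z _.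
rewrite -[RHS]sum1_card big_mkcond [RHS]big_mkcond /=.
by apply: eq_bigr => u _; rewrite inE; case: (inC _ _ _); case: (Z \subset _).
Qed.

(** By [sum_Bw_bin] and [card_coset_zeros] the coset and the code share the binomial moments of
    order [r] with [r + d.-1 <= n]. Their difference is inverted with [D = d.-1]. *)
Lemma Bw_Bonneau x w : (d.-1 <= w <= n)%N ->
  (Bw m d w x)%:Z = (Aw m d w)%:Z + sgn w d *
    \sum_(i < d.-1) ((Bw m d i x)%:Z - (Aw m d i)%:Z) *
       ('C(n - i, n - w) * 'C(w.-1 - i, d - 2 - i))%:R.
Proof.
move=> wn; apply/eqP; rewrite addrC -subr_eq; apply/eqP.
rewrite (@binomial_moments_inversion n d.-1
  (fun i => (Bw m d i x)%:Z - (Aw m d i)%:Z)) => [||r rn|//].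
- rewrite /sgn (_ : (w + d.-1).+1 = (w + d)%N); last by lia.
  by rewrite (_ : d.-1.-1 = (d - 2)%N) //; lia.
- by lia.
under eq_bigr do rewrite mulrBl.
rewrite sumrB; apply/eqP; rewrite subr_eq0; apply/eqP.
have e y : \sum_(i < n.+1) (Bw m d i y)%:Z * 'C(n - i, r)%:R =
    (\sum_(i < n.+1) Bw m d i y * 'C(n - i, r))%N%:Z.
  by rewrite -natz natr_sum; apply: eq_bigr => i _; rewrite natrM !natz.
rewrite /Aw !e !sum_Bw_bin; congr Posz; apply: eq_bigr => Z /eqP cZ.
by apply: card_coset_zeros; rewrite cZ.
Qed.

Lemma Bw_determined x y :
  (forall i, (i <= d - 2)%N -> Bw m d i x = Bw m d i y) ->
  forall w, Bw m d w x = Bw m d w y.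
Proof.
move=> e w; have [wd|dw] := leqP w (d - 2); first exact: e.
have [wn|nw] := leqP w n; last by rewrite !Bw_gt.
have dwn : (d.-1 <= w <= n)%N by rewrite wn andbT; lia.
apply/eqP; rewrite -eqz_nat (Bw_Bonneau x dwn) (Bw_Bonneau y dwn); apply/eqP; congr (_ + _ * _).
by apply: eq_bigr => i _; rewrite e //; have := ltn_ord i; lia.
Qed.

(** A coset vector of weight [i] differs from [x] by a codeword of weight below d, hence equals
    [x]. *)
Lemma Bw_leader (x : vec) i : (i + wt x < d)%N -> Bw m d i x = (i == wt x).
Proof.
move=> ix; have low (u : vec) : inC m d (u - x) -> wt u = i -> u = x.
  move=> uC ui; apply/eqP; rewrite -subr_eq0; apply/eqP/inC_min_dist => //.
  by apply: leq_ltn_trans (wt_sub_le _ _) _; rewrite ui.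
have [ei|ni] := eqVneq i (wt x).
  rewrite /Bw (_ : [set u | _] = [set x]) ?cards1 //; apply/setP => u; rewrite !inE.
  apply/andP/eqP => [[uC /eqP ui]|->]; first exact: low.
  by rewrite subrr inC0 ei.
apply/eqP; rewrite cards_eq0; apply/eqP/setP => u; rewrite !inE.
by apply: contraNF ni => /andP[uC /eqP ui]; rewrite -ui (low u).
Qed.

Lemma wt_v2 (j1 j2 : 'I_n) (g1 g2 : F) :
  j1 != j2 -> g1 != 0 -> g2 != 0 -> wt (v2 j1 j2 g1 g2) = 2%N.
Proof.
move=> j12 h1 h2; rewrite /wt (_ : [set j | _] = [set j1; j2]) ?cards2 ?j12 //.
apply/setP => j; rewrite !inE mxE; case: (j =P j1) => [_|_]; first by rewrite h1.
by case: (j =P j2) => [_|_]; rewrite ?h2 ?eqxx.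
Qed.

Lemma wt2_v2 (u : vec) : wt u = 2%N -> exists (j1 j2 : 'I_n) (g1 g2 : F),
  [/\ j1 != j2, g1 != 0, g2 != 0 & u = v2 j1 j2 g1 g2].
Proof.
move/eqP => /cards2P[j1 [j2 [j12 /setP e]]]; exists j1, j2, (u 0 j1), (u 0 j2).
have := e j1; have := e j2; rewrite !inE !eqxx orbT => h2 h1; split=> //.
apply/rowP => j; rewrite mxE; case: (j =P j1) => [->//|/eqP n1].
case: (j =P j2) => [->//|/eqP n2].
by have := e j; rewrite !inE (negPf n1) (negPf n2) => /negbFE/eqP.
Qed.

(** * Cosets with a leader of weight two *)

Section WeightTwo.
Variables (j1 j2 : 'I_n) (g1 g2 : F).
Hypotheses (j12 : j1 != j2) (g1_neq0 : g1 != 0) (g2_neq0 : g2 != 0).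
Hypothesis d_ge5 : (5 <= d)%N.
Local Notation x := (v2 j1 j2 g1 g2).
Local Notation D := (~: [set j1; j2]).

(** A coordinate on the projective line with zero at [j1] and pole at [j2]. *)
Definition det_ratio (k : 'I_n) : F := col_det j1 k / col_det j2 k.

Lemma in_setC_pair k : (k \in D) = (col_det j1 k != 0) && (col_det j2 k != 0).
Proof. by rewrite !inE negb_or !col_det_eq0 ![_ == k]eq_sym. Qed.

(** Equal ratios make the left side of [col_det_pluecker] vanish, and [col_det j1 j2] is nonzero. *)
Lemma det_ratio_inj : {in D &, injective det_ratio}.
Proof.
move=> k k'; rewrite !in_setC_pair => /andP[_ k2] /andP[_ k2'] /eqP.
rewrite /det_ratio eqr_div // => /eqP e; have := col_det_pluecker j1 j2 k k'.
rewrite e subrr => /esym/eqP; rewrite mulf_eq0 !col_det_eq0 (negPf j12) /=.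
by move/eqP.
Qed.

Lemma det_ratio_im : det_ratio @: D = [set~ 0].
Proof.
apply/eqP; rewrite eqEcard; apply/andP; split.
  apply/subsetP => a /imsetP[k]; rewrite in_setC_pair => /andP[k1 k2] ->.
  by rewrite !inE mulf_neq0 ?invr_neq0.
rewrite (card_in_imset det_ratio_inj) cardsC1.
by have := cardsC [set j1; j2]; rewrite card_ord cards2 j12 add2n => -[e]; rewrite -ltnS [X in (_ < X)%N]e ltn_predL; apply/card_gt0P; exists 0.
Qed.

Lemma supp_v2 : supp x = [set j1; j2].
Proof.
apply/setP => j; rewrite !inE mxE; case: (j =P j1) => [_|_]; first by rewrite g1_neq0.
by case: (j =P j2) => [_|_]; rewrite ?g2_neq0 ?eqxx.
Qed.

(** The nonzero codeword [u - x] has weight at least d, while the two supports have at most (d-2) +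
    2 elements together; equality forces them to be disjoint. *)
Lemma supp_disjoint_v2 (u : vec) : inC m d (u - x) -> u != x ->
  (wt u <= d - 2)%N -> wt u = (d - 2)%N /\ supp u \subset D.
Proof.
move=> uC ux wu; have wx := wt_v2 j12 g1_neq0 g2_neq0.
have wge : (d <= wt (u - x))%N.
  rewrite leqNgt; apply: contra ux => wlt.
  by rewrite -subr_eq0; apply/eqP/inC_min_dist.
have dU : (d <= #|supp u :|: supp x|)%N.
  exact: leq_trans wge (subset_leq_card (supp_sub u x)).
have eUI : (#|supp u :|: supp x| + #|supp u :&: supp x| = wt u + 2)%N.
  by rewrite cardsUI !card_supp wx.
split; first by lia.
rewrite -disjoints_subset -setI_eq0 -supp_v2 -cards_eq0.
suff -> : #|supp u :&: supp x| = 0%N by [].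
by lia.
Qed.

(** In the parity check for [S] applied to the leader only the terms at [j1] and [j2] remain;
    dividing by the product at [j2] gives the condition. *)
Lemma coset_rep_v2 (S : {set 'I_n}) : #|S| = (d - 2)%N -> S \subset D ->
  (exists u, inC m d (u - x) /\ supp u \subset S) <->
  \prod_(k in S) det_ratio k = - g2 / g1.
Proof.
move=> cS SD; have [y yS] := exists_vanishing_comb cS.
rewrite (coset_rep_vanishing x cS yS).
have nzS j : j \in [set j1; j2] -> \prod_(k in S) col_det j k != 0.
  move=> jD; rewrite prod_col_det_neq0; apply/negP => /(subsetP SD).
  by rewrite inE jD.
have n1 := nzS j1 (set21 _ _); have n2 := nzS j2 (set22 _ _).
have j21 : j2 != j1 by rewrite eq_sym.
rewrite (bigD1 j1) //= (bigD1 j2) //= big1; last first.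
  by move=> j /andP[a b]; rewrite [X in _ * X]mxE (negPf a) (negPf b) mulr0.
rewrite !yS !mxE !eqxx (negPf j21) addr0.
rewrite big_split /= prodfV; split=> [/eqP|/eqP].
  by rewrite addr_eq0 => /eqP e; apply/eqP; rewrite eqr_div // e; apply/eqP; ring.
by rewrite eqr_div // => /eqP ->; ring.
Qed.

(** Taking supports is a bijection from the coset vectors of weight d-2 onto the sets of
    [coset_rep_v2]. *)
Lemma Bw_v2_Ptimes : Bw m d (d - 2) x = Ptimes (d - 2) (- g2 / g1).
Proof.
rewrite -(card_prod_subsets_Ptimes (d - 2) (- g2 / g1) det_ratio_inj det_ratio_im).
rewrite /Bw; set A := [set u | _]; set P := [set S : {set 'I_n} | _].
have wx := wt_v2 j12 g1_neq0 g2_neq0.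
have AD u : u \in A -> supp u \subset D.
  rewrite inE => /andP[uC /eqP wu].
  have ux : u != x by apply/eqP => e; move: wu; rewrite e wx; lia.
  by have [] := supp_disjoint_v2 uC ux; rewrite ?wu.
have <- : supp @: A = P.
  apply/setP => S; rewrite inE; apply/imsetP/and3P => [[u uA ->] | [SD /eqP cS pS]].
    have uD := AD u uA; move: uA; rewrite inE => /andP[uC wu].
    split=> //; apply/eqP/coset_rep_v2 => //; first exact/eqP.
    by exists u.
  have [u [uC uS]] : exists u, inC m d (u - x) /\ supp u \subset S.
    by apply/coset_rep_v2 => //; apply/eqP.
  have ux : u != x.
    apply: contraTneq uS => ->; rewrite supp_v2; apply/negP => h.
    have := subset_trans h SD; rewrite subsets_disjoint setCK.
    by rewrite -setI_eq0 setIid => /eqP/setP/(_ j1); rewrite !inE eqxx.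
  have wS : (wt u <= d - 2)%N by rewrite -cS subset_leq_card.
  have [wu _] := supp_disjoint_v2 uC ux wS.
  exists u; first by rewrite inE uC wu eqxx.
  by apply/eqP; rewrite eq_sym eqEcard uS cS -wu /supp /wt leqnn.
(* Two such vectors with the same support differ by a codeword of weight at most d-2. *)
rewrite card_in_imset // => u v uA vA euv.
apply/eqP; rewrite -subr_eq0; apply/eqP/inC_min_dist.
  move: uA vA; rewrite !inE => /andP[uC _] /andP[vC _].
  by apply: inC_sub_trans uC _; rewrite inC_sub_sym.
have := subset_leq_card (supp_sub u v); rewrite -euv setUid.
move: uA; rewrite inE => /andP[_ /eqP wu]; rewrite !card_supp wu => le_w.
by apply: leq_ltn_trans le_w _; lia.
Qed.

Lemma Bw_v2_low i : (i <= d - 3)%N -> Bw m d i x = (i == 2%N).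
Proof.
have wx := wt_v2 j12 g1_neq0 g2_neq0.
by move=> id; rewrite Bw_leader wx //; lia.
Qed.

(** Only three indices contribute to the sum of [Bw_Bonneau]: 0, through the zero codeword, gives
    [Omega0]; 2, through the leader, gives [Omega2]; and d-2 gives the subset count. *)
Lemma Bw_v2_high w : (d - 1 <= w <= n)%N ->
  (Bw m d w x)%:Z = (Aw m d w)%:Z - Omega0 #|F| d w + Omega2 #|F| d w
    + sgn w d * ('C(#|F| + 3 - d, n - w) * Ptimes (d - 2) (- g2 / g1))%N%:Z.
Proof.
move=> wn; have wn' : (d.-1 <= w <= n)%N by lia.
rewrite Bw_Bonneau // -!addrA; congr (_ + _).
pose t i : int := ((Bw m d i x)%:Z - (Aw m d i)%:Z) *
       ('C(n - i, n - w) * 'C(w.-1 - i, d - 2 - i))%:R.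
have A_low i : (i < d)%N -> Aw m d i = (i == 0%N).
  have w0 : wt (0 : vec) = 0%N by apply/eqP/wt0P.
  by move=> id; rewrite /Aw Bw_leader w0 ?addn0.
rewrite (eq_bigr (fun i : 'I_d.-1 => t i)) // -(big_mkord xpredT t).
(* With [d = d'.+4] the indices run from 0 to [d'.+2]; [d' > 0] keeps 2 apart from the last one. *)
have [d' ed] : exists d', d = d'.+4 by exists (d - 4)%N; lia.
have d'0 : (0 < d')%N by lia.
rewrite (_ : d.-1 = d'.+3); last by rewrite ed.
rewrite big_nat_recr //= big_ltn // big_ltn // big_ltn //.
rewrite big_nat_cond big1 => [|i /andP[/andP[i3 id] _]]; last first.
  by rewrite /t Bw_v2_low ?A_low ?subrr ?mul0r //; lia.
rewrite /t (_ : d'.+2 = d - 2)%N ?Bw_v2_Ptimes; last by lia.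
rewrite !Bw_v2_low ?A_low; try lia.
rewrite (_ : (d - 2 == 0)%N = false) ?subnn ?bin0 ?muln1; last by lia.
rewrite /Omega0 /Omega2 !subn0 bin_sub; last by lia.
have -> : 'C(n - 2, n - w) = 'C(#|F|.-1, w - 2).
  by rewrite -bin_sub; [congr binomial; lia | lia].
have -> : (w.-1 - 2 = w - 3)%N by lia.
have -> : (d - 2 - 2 = d - 4)%N by lia.
have -> : (n - (d - 2) = #|F| + 3 - d)%N by lia.
by rewrite /= !natz !PoszM; ring.
Qed.

End WeightTwo.

(** * Coset weights and uniformity over all cosets of weight two *)

Lemma coset_wt_attained x : (coset_wt m d x < n)%N ->
  exists u, inC m d (u - x) /\ wt u = coset_wt m d x.
Proof.
(* The first alternative covers the default value [n] of the minimum, which the strict bound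
   excludes. *)
pose K r := r = n \/ exists u, inC m d (u - x) /\ wt u = r.
suff : K (coset_wt m d x) by case=> [->|//]; rewrite ltnn.
apply: (big_rec K) => [|u r uC IH]; first by left.
by case: (leqP (wt u) r) => [_|_] //; right; exists u.
Qed.

(** A lighter vector in the coset would differ from [x] by a codeword of weight below d. *)
Lemma coset_wt_leader (x : vec) : ((wt x).*2 <= d)%N -> coset_wt m d x = wt x.
Proof.
move=> wx; apply/eqP; rewrite eqn_leq; apply/andP; split.
  rewrite /coset_wt -minEnat -leEnat; apply: (bigmin_le_cond _ (j := x)).
  by rewrite subrr inC0.
rewrite /coset_wt -minEnat -leEnat; apply: le_bigmin => [|u uC].
  by rewrite leEnat wt_le.
rewrite leEnat leqNgt; apply/negP => wu; move: (wu).
suff -> : u = x by rewrite ltnn.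
apply/eqP; rewrite -subr_eq0; apply/eqP/inC_min_dist => //.
by apply: leq_ltn_trans (wt_sub_le _ _) _; lia.
Qed.

Hypothesis d_ge5 : (5 <= d)%N.

(** Among the counts up to weight d-2, which determine all others, only the one at d-2 depends on
    the leader. *)
Lemma Bw_v2_indep (j1 j2 j1' j2' : 'I_n) (g1 g2 g1' g2' : F) :
  j1 != j2 -> g1 != 0 -> g2 != 0 -> j1' != j2' -> g1' != 0 -> g2' != 0 ->
  Ptimes (d - 2) (- g2 / g1) = Ptimes (d - 2) (- g2' / g1') ->
  forall w, Bw m d w (v2 j1 j2 g1 g2) = Bw m d w (v2 j1' j2' g1' g2').
Proof.
move=> ? ? ? ? ? ? e; apply: Bw_determined => i; rewrite leq_eqVlt => /orP[/eqP->|id].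
  by rewrite !Bw_v2_Ptimes.
by rewrite !Bw_v2_low //; lia.
Qed.

Lemma Bw_eq_leader_le1 (x y : vec) : wt x = wt y -> (wt x <= 1)%N ->
  forall w, Bw m d w x = Bw m d w y.
Proof.
by move=> e wx; apply: Bw_determined => i id; rewrite !Bw_leader -?e //; lia.
Qed.

Lemma coset_wt2_v2 x : coset_wt m d x = 2%N -> exists (j1 j2 : 'I_n) (g1 g2 : F),
  [/\ j1 != j2, g1 != 0, g2 != 0 &
      forall w, Bw m d w x = Bw m d w (v2 j1 j2 g1 g2)].
Proof.
move=> x2; have [|u [uC]] := @coset_wt_attained x; first by rewrite x2; lia.
rewrite x2 => /wt2_v2[j1 [j2 [g1 [g2 [? ? ? eu]]]]]; exists j1, j2, g1, g2; split=> // w.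
by rewrite -eu; apply/esym/eq_Bw_coset.
Qed.

Lemma Pplus_uniformP :
  (forall l1 l2 : 'I_#|F|.-1,
      Pplus #|F|.-1 (d - 2) l1 = Pplus #|F|.-1 (d - 2) l2) <->
  (forall x y, coset_wt m d x = 2%N -> coset_wt m d y = 2%N ->
      forall w, Bw m d w x = Bw m d w y).
Proof.
have [beta pb] := exists_primitive_element F.
have b0 : beta != 0 by rewrite (prim_root_eq0 pb) -lt0n (prim_order_gt0 pb).
split=> [e x y /coset_wt2_v2[a [b [g [h [ab g0 h0 ex]]]]]
              /coset_wt2_v2[a' [b' [g' [h' [ab' g0' h0' ey]]]]] w | e l1 l2].
  have nz (s t : F) : s != 0 -> t != 0 -> - t / s != 0.
    by move=> s0 t0; rewrite mulf_neq0 ?invr_neq0 // oppr_eq0.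
  rewrite ex ey; apply: Bw_v2_indep => //.
  have [i ->] := prim_rootP pb (expf_card_pred (nz _ _ g0 h0)).
  have [j ->] := prim_rootP pb (expf_card_pred (nz _ _ g0' h0')).
  by rewrite -!(Pplus_Ptimes pb).
(* Every residue [l] is realised by a leader: here [- g2 / g1] is [beta ^+ l]. *)
pose x (l : 'I_#|F|.-1) := v2 (ord0 : 'I_n) ord_max 1 (- beta ^+ l).
have od : ord0 != ord_max :> 'I_n.
  by rewrite -(inj_eq val_inj) /= eq_sym -lt0n; apply/card_gt0P; exists 0.
have nz (l : 'I_#|F|.-1) : - beta ^+ l != 0 by rewrite oppr_eq0 expf_neq0.
have x2 l : coset_wt m d (x l) = 2%N.
  by rewrite coset_wt_leader wt_v2 ?oner_eq0 //; lia.
have := e (x l1) (x l2) (x2 l1) (x2 l2) (d - 2)%N.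
by rewrite !Bw_v2_Ptimes ?oner_eq0 // !opprK !divr1 -!(Pplus_Ptimes pb).
Qed.

Lemma Pplus_uniform_formulas :
  (forall l1 l2 : 'I_#|F|.-1,
      Pplus #|F|.-1 (d - 2) l1 = Pplus #|F|.-1 (d - 2) l2) ->
  forall x, coset_wt m d x = 2%N -> uniform_w2_formulas m d x.
Proof.
move=> e x /coset_wt2_v2[a [b [g [h [ab g0 h0 eB]]]]].
have [beta pb] := exists_primitive_element F.
have q0 := prim_order_gt0 pb.
have nz : - h / g != 0 by rewrite mulf_neq0 ?invr_neq0 // oppr_eq0.
have [i ei] := prim_rootP pb (expf_card_pred nz).
(* The common value of [Pplus] is its average over all residues. *)
have cE : ('C(#|F|.-1, d - 2))%:R / (#|F|.-1)%:R =
    (Ptimes (d - 2) (- h / g))%:R :> rat.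
  rewrite ei -(Pplus_Ptimes pb) -(Pplus_uniform i e) natrM mulrC mulKf //.
  by rewrite pnatr_eq0 -lt0n.
rewrite /uniform_w2_formulas /= cE; split.
- by move=> w wd w2; rewrite eB Bw_v2_low //; case: eqP.
- by rewrite eB Bw_v2_low //; lia.
- by rewrite eB Bw_v2_Ptimes.
- rewrite -cE; apply/eqP; rewrite eqr_div ?pnatr_eq0 -?lt0n //; last by lia.
  rewrite -!natrM eqr_nat mulnC; apply/eqP.
  (* Absorption: (d-2) 'C(q-1, d-2) = (q-1) 'C(q-2, d-3). *)
  have -> : (d - 2 = (d - 3).+1)%N by lia.
  have -> : (#|F| - 2 = #|F|.-1.-1)%N by lia.
  by rewrite -mul_bin_diag mulnC.
- move=> w wn; rewrite eB.
  transitivity (((Bw m d w (v2 a b g h))%:Z)%:~R : rat); first by [].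
  rewrite Bw_v2_high // rmorphD /= rmorphM /= PoszM rmorphM /=.
  by rewrite mulrA.
Qed.

End GDRS.

Theorem theorem5p1 (F : finFieldType) (d : nat) (m : 'I_#|F| -> F) :
  (5 <= d)%N -> (d <= #|F|)%N ->
  bijective m ->
  (forall k : 'I_#|F|, (m k == 0)%R = (val k == #|F|.-1)) ->
  (* (i) *)
  (forall (j1 j2 : 'I_#|F|.+1) (g1 g2 beta : F) (lam0 : 'I_#|F|.-1),
     j1 != j2 -> (g1 != 0)%R -> (g2 != 0)%R ->
     (#|F|.-1).-primitive_root%R beta -> (beta ^+ lam0 = - g2 / g1)%R ->
     [/\ forall j1' j2' : 'I_#|F|.+1, j1' != j2' ->
           forall w, Bw m d w (v2 j1' j2' g1 g2) = Bw m d w (v2 j1 j2 g1 g2),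
         forall w : nat, (w <= d - 3)%N -> w <> 2%N ->
           Bw m d w (v2 j1 j2 g1 g2) = 0%N,
         Bw m d 2 (v2 j1 j2 g1 g2) = 1%N,
         Bw m d (d - 2) (v2 j1 j2 g1 g2) = Pplus #|F|.-1 (d - 2) lam0
           /\ Pplus #|F|.-1 (d - 2) lam0 = Ptimes (d - 2) (- g2 / g1)%R &
         forall w : nat, (d - 1 <= w <= #|F|.+1)%N ->
           ((Bw m d w (v2 j1 j2 g1 g2))%:Z =
             (Aw m d w)%:Z - Omega0 #|F| d w + Omega2 #|F| d w
             + sgn w d * ('C(#|F| + 3 - d, #|F|.+1 - w)
                          * Pplus #|F|.-1 (d - 2) lam0)%N%:Z)%R]) /\
  (* (ii) *)
  ((forall l1 l2 : 'I_#|F|.-1,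
      Pplus #|F|.-1 (d - 2) l1 = Pplus #|F|.-1 (d - 2) l2) <->
   (forall x y : 'rV[F]_(#|F|.+1), coset_wt m d x = 2%N -> coset_wt m d y = 2%N ->
      forall w, Bw m d w x = Bw m d w y)) /\
  ((forall l1 l2 : 'I_#|F|.-1,
      Pplus #|F|.-1 (d - 2) l1 = Pplus #|F|.-1 (d - 2) l2) ->
   forall x : 'rV[F]_(#|F|.+1), coset_wt m d x = 2%N -> uniform_w2_formulas m d x) /\
  (* (iii) *)
  (coprime #|F|.-1 (d - 2) ->
   [/\ forall l1 l2 : 'I_#|F|.-1,
         Pplus #|F|.-1 (d - 2) l1 = Pplus #|F|.-1 (d - 2) l2,
       forall x y : 'rV[F]_(#|F|.+1), coset_wt m d x = 2%N -> coset_wt m d y = 2%N ->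
         forall w, Bw m d w x = Bw m d w y,
       forall x : 'rV[F]_(#|F|.+1), coset_wt m d x = 2%N -> uniform_w2_formulas m d x,
       two_regular m d &
       (#|F|.-1 %| 'C(#|F|.-1, d - 2))%N]).
Proof.
move=> d5 dq /bij_inj m_inj _.
have d2 : 2 <= d by lia.
have dn : d <= #|F|.+1 by lia.
have [beta0 pb0] := exists_primitive_element F.
split.
  move=> j1 j2 g1 g2 beta lam0 j12 g10 g20 pb eb.
  have PP : Pplus #|F|.-1 (d - 2) lam0 = Ptimes (d - 2) (- g2 / g1)%R.
    by rewrite (Pplus_Ptimes pb) eb.
  split.
  - by move=> j1' j2' j12' w; apply: Bw_v2_indep.
  - by move=> w wd w2; rewrite Bw_v2_low //; case: eqP.
  - by rewrite Bw_v2_low //; lia.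
  - by split=> //; rewrite Bw_v2_Ptimes.
  - by move=> w wn; rewrite PP; apply: Bw_v2_high.
have uniP := Pplus_uniformP m_inj d2 dn d5.
have uniF := Pplus_uniform_formulas m_inj d2 dn d5.
split=> //; split=> // co.
have uni (l1 l2 : 'I_#|F|.-1) :
    Pplus #|F|.-1 (d - 2) l1 = Pplus #|F|.-1 (d - 2) l2.
  have b0 : (beta0 != 0)%R by rewrite (prim_root_eq0 pb0) -lt0n (prim_order_gt0 pb0).
  by rewrite !(Pplus_Ptimes pb0) (Ptimes_coprime pb0 co _ _ (h := (beta0 ^+ l2)%R)) ?expf_neq0.
split=> //; [exact/uniP | exact: uniF | | ]; last first.
  have l : 'I_#|F|.-1 := Ordinal (prim_order_gt0 pb0).
  by rewrite -(Pplus_uniform l uni) dvdn_mulr.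
(* For 2-regularity, weight 2 is the uniformity just obtained; for weights 0 and 1 both cosets are
   replaced by those of their leaders. *)
move=> W W2 x y xW yW w.
have [W_eq2 | W_ne2] := eqVneq W 2; first by apply: (proj1 uniP uni); rewrite ?xW ?yW.
have [|u [uC wu]] := @coset_wt_attained F m d x; first by rewrite xW; lia.
have [|v [vC wv]] := @coset_wt_attained F m d y; first by rewrite yW; lia.
rewrite -(eq_Bw_coset w uC) -(eq_Bw_coset w vC).
by apply: Bw_eq_leader_le1; rewrite ?wu ?wv ?xW ?yW //; lia.
Qed.
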